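(* Let $a,b$ be integers with $b\ge1$, $0\le a\le b-1$, and let $[[a]]_b=\{a+bk\mid k\in\mathbb{Z}\}$. Let $m\ge2$ and $n\ge2$ be the minimal integers greater than or equal to $2$ for which the congruences $$ma\equiv a\pmod b,\qquad a^{n}\equiv a\pmod b$$ hold simultaneously (assuming such integers exist). Then $$\mathcal{R}^{[a,b]}_{m,n}=\langle[[a]]_b\mid\nu_m,\mu_n\rangle,\qquad \nu_m[x_1,\ldots,x_m]=x_1+\cdots+x_m,\quad \mu_n[x_1,\ldots,x_n]=x_1x_2\cdots x_n,$$ (with ordinary sums and products in $\mathbb{Z}$) is a polyadic $(m,n)$-ring, and the numbers $I=(m-1)\dfrac{a}{b}$ and $J=\dfrac{a^n-a}{b}$ (its polyadic shape invariants) are integers.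
   Context: A polyadic $(m,n)$-ring is a set $A$ with operations $\nu_m:A^m\to A$ (addition) and $\mu_n:A^n\to A$ (multiplication) such that: (1) $\mu_n$ distributes over $\nu_m$ on every place: for each $i\in\{1,\ldots,n\}$ and all elements, $$\mu_n[b_1,\ldots,b_{i-1},\nu_m[a_1,\ldots,a_m],b_{i+1},\ldots,b_n]=\nu_m\big[\mu_n[b_1,\ldots,b_{i-1},a_1,b_{i+1},\ldots,b_n],\ldots,\mu_n[b_1,\ldots,b_{i-1},a_m,b_{i+1},\ldots,b_n]\big];$$ (2) $\langle A\mid\mu_n\rangle$ is an $n$-ary semigroup, i.e. $\mu_n$ is totally associative (the value of a composition of two $\mu_n$'s on a string of $2n-1$ elements does not depend on the placement of the inner operation); (3) $\langle A\mid\nu_m\rangle$ is a commutative $m$-ary group, i.e. $\nu_m$ is totally associative, invariant under permutations of arguments, and the equation $\nu_m[\mathbf{a},x,\mathbf{b}]=c$ is solvable for $x$ on any place. *)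

(* Defs.v *)
From HB Require Import structures.
From mathcomp Require Import all_boot all_order all_fingroup all_algebra.
From mathcomp Require Import boolp classical_sets.
Set Implicit Arguments.
Unset Strict Implicit.
Unset Printing Implicit Defensive.
Import Order.TTheory GRing.Theory Num.Theory.

Local Open Scope nat_scope.

Definition nary_op (n : nat) (A : Type) := n.-tuple A -> A.

Definition replace (A : Type) (n : nat) (t : n.-tuple A) (i : 'I_n) (y : A) :
  n.-tuple A := [tuple if k == i then y else tnth t k | k < n].

(* The composition f[x_0, .., x_(i-1), f[x_i, .., x_(i+n-1)], x_(i+n), ..,
   x_(2n-2)]. The string is indexed by nat to avoid casts; for i : 'I_n only
   its first 2n-1 entries are read. *)
Definition nested (A : Type) (n : nat) (f : nary_op n A) (x : nat -> A)
  (i : 'I_n) : A :=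
  f [tuple if k < i then x k
           else if k == i then f [tuple x (i + l) | l < n]
           else x (k + n.-1) | k < n].

Definition totally_associative (A : Type) (n : nat) (f : nary_op n A) : Prop :=
  forall (x : nat -> A) (i j : 'I_n), nested f x i = nested f x j.

Definition permutation_invariant (A : Type) (n : nat) (f : nary_op n A) :
  Prop :=
  forall (s : 'S_n) (x : n.-tuple A), f [tuple tnth x (s k) | k < n] = f x.

(* As usual for n-ary groups, only existence of a solution is required;
   uniqueness is a consequence of associativity. The entry of t at place i
   is irrelevant. *)
Definition solvable_on_any_place (A : Type) (n : nat) (f : nary_op n A) :
  Prop :=
  forall (i : 'I_n) (t : n.-tuple A) (c : A), exists x : A,
    f (replace t i x) = c.

Definition distributive_on_every_place (A : Type) (m n : nat)
  (nu : nary_op m A) (mu : nary_op n A) : Prop :=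
  forall (i : 'I_n) (b : n.-tuple A) (a : m.-tuple A),
    mu (replace b i (nu a)) =
    nu [tuple mu (replace b i (tnth a k)) | k < m].

Definition nary_semigroup (A : Type) (n : nat) (f : nary_op n A) : Prop :=
  totally_associative f.

Definition commutative_nary_group (A : Type) (n : nat) (f : nary_op n A) :
  Prop :=
  [/\ totally_associative f, permutation_invariant f
    & solvable_on_any_place f].

Definition polyadic_ring (A : Type) (m n : nat)
  (nu : nary_op m A) (mu : nary_op n A) : Prop :=
  [/\ distributive_on_every_place nu mu, nary_semigroup mu
    & commutative_nary_group nu].

Local Open Scope ring_scope.
Local Open Scope classical_set_scope.

Definition residue_class (a b : int) : set int :=
  [set a + b * k | k in [set: int]].

Definition shape_congruences (a b : int) (m n : nat) : Prop :=
  (m%:Z * a = a %[mod b])%Z /\ (a ^+ n = a %[mod b])%Z.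

Definition minimal_arities (a b : int) (m n : nat) : Prop :=
  [/\ (2 <= m)%N, (2 <= n)%N, shape_congruences a b m n
    & forall m' n' : nat, (2 <= m')%N -> (2 <= n')%N ->
        shape_congruences a b m' n' -> (m <= m')%N /\ (n <= n')%N].

(* Main.v *)
Require Import Defs.
From HB Require Import structures.
From mathcomp Require Import all_boot all_order all_fingroup all_algebra.
From mathcomp Require Import boolp classical_sets.
Set Implicit Arguments.
Unset Strict Implicit.
Unset Printing Implicit Defensive.
Import Order.TTheory GRing.Theory Num.Theory.
Local Open Scope ring_scope.

(** The class of a modulo b consists of the integers congruent to a.  A sum of
    m of them is congruent to m a and a product of n of them to a ^ n, so the
    two shape congruences say exactly that the class is closed under m-ary
    addition and n-ary multiplication ([residue_class_sum],
    [residue_class_prod]), and also that b divides the numerators of I and J.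

    The equational axioms then come from the ring of integers, because the
    inclusion of the class is injective and turns the operations into iterated
    sums and products: total associativity because both nestings flatten to the
    same iterated operation on 2n - 1 entries ([big_nested]), the rest from
    commutativity and from the distributivity of Z.  The only existence
    statement is solvability: the integer solution is c minus the other m - 1
    entries, and it is congruent to a since (m - 1) a vanishes modulo b. *)

(** Stated for a possibly noncommutative monoid: flattening preserves the order
    of the entries, so one lemma serves sums and products alike. *)
Lemma big_nested (R : Type) (idx : R) (op : Monoid.law idx) (n : nat)
    (x : nat -> R) (i : 'I_n) :
  \big[op/idx]_(k < n) (if (k < i)%N then x k
     else if k == i then \big[op/idx]_(l < n) x (i + l)%N
     else x (k + n.-1)%N) = \big[op/idx]_(0 <= k < n + n.-1) x k.
Proof.
have n_gt0 : (0 < n)%N by apply: leq_ltn_trans (ltn_ord i).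
pose y k := if (k < i)%N then x k
     else if k == i :> nat then \big[op/idx]_(l < n) x (i + l)%N
     else x (k + n.-1)%N.
rewrite -(big_mkord xpredT y) (@big_cat_nat _ _ _ i) //=; last exact: ltnW.
rewrite (@big_ltn _ _ _ i) //.
rewrite [RHS](@big_cat_nat _ _ _ i) //=; last first.
  exact: leq_trans (ltnW (ltn_ord i)) (leq_addr _ _).
congr (op _ _).
  by apply: eq_big_nat => k /andP[_ lt_ki]; rewrite /y lt_ki.
rewrite [RHS](@big_cat_nat _ _ _ (i + n)) ?leq_addr //=; last first.
  by rewrite addnC leq_add2l -ltnS prednK.
congr (op _ _).
  (* The entry at place i is the block of indices from i to i + n - 1. *)
  rewrite /y ltnn eqxx -[X in \big[_/_]_(X <= _ < _) _]add0n big_addn addKn big_mkord.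
  by apply: eq_bigr => l _; rewrite addnC.
have -> : (i + n = i.+1 + n.-1)%N by rewrite addSnnS prednK.
rewrite big_addn addnK; apply: eq_big_nat => k /andP[lt_ik _].
by rewrite /y ltnNge (ltnW lt_ik) /= gtn_eqF.
Qed.

Lemma residue_classP (a b x : int) :
  reflect (residue_class a b x) (b %| x - a)%Z.
Proof.
apply: (iffP dvdzP) => [[k Ek]|[k _ <-]].
  by exists k => //; rewrite mulrC -Ek addrC subrK.
by exists k; rewrite addrAC subrr add0r mulrC.
Qed.

Lemma mem_residue_class (a b x : int) :
  (x \in residue_class a b) = (b %| x - a)%Z.
Proof. by apply/idP/residue_classP; rewrite inE. Qed.

Lemma dvdz_residue (a b : int) (x : residue_class a b) : (b %| val x - a)%Z.
Proof. by rewrite -mem_residue_class; apply: valP. Qed.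

Lemma sum_congr (I : finType) (P : pred I) (b : int) (F G : I -> int) :
  (forall i, P i -> (b %| F i - G i)%Z) ->
  (b %| \sum_(i | P i) F i - \sum_(i | P i) G i)%Z.
Proof. by move=> FG; rewrite -sumrB; apply: rpred_sum. Qed.

Lemma prod_congr (I : finType) (P : pred I) (b : int) (F G : I -> int) :
  (forall i, P i -> (b %| F i - G i)%Z) ->
  (b %| \prod_(i | P i) F i - \prod_(i | P i) G i)%Z.
Proof.
move=> FG; apply: (big_ind2 (fun u v => (b %| u - v)%Z)); last exact: FG.
  by rewrite subrr dvdz0.
move=> u u' v v' uu' vv'.
have -> : u * v - u' * v' = (u - u') * v + u' * (v - v').
  by rewrite mulrBl mulrBr addrA subrK.
by rewrite rpredD ?(dvdz_mulr _ uu') ?(dvdz_mull _ vv').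
Qed.

Lemma residue_class_sum (a b : int) (m : nat) (x : 'I_m -> int) :
  (b %| m%:Z * a - a)%Z -> (forall i, b %| x i - a)%Z ->
  \sum_i x i \in residue_class a b.
Proof.
move=> ma_a xa; rewrite mem_residue_class.
have := @sum_congr _ xpredT b x (fun=> a) (fun i _ => xa i).
rewrite sumr_const card_ord -mulr_natl natz => x_ma.
by have := rpredD x_ma ma_a; rewrite addrA subrK.
Qed.

Lemma residue_class_prod (a b : int) (n : nat) (x : 'I_n -> int) :
  (b %| a ^+ n - a)%Z -> (forall i, b %| x i - a)%Z ->
  \prod_i x i \in residue_class a b.
Proof.
move=> an_a xa; rewrite mem_residue_class.
have := @prod_congr _ xpredT b x (fun=> a) (fun i _ => xa i).
rewrite prodr_const card_ord => x_an.
by have := rpredD x_an an_a; rewrite addrA subrK.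
Qed.

Lemma val_big_associative (R : Type) (idx : R) (op : Monoid.law idx)
    (P : pred R) (A : subType P) (n : nat) (f : nary_op n A) :
  (forall x, val (f x) = \big[op/idx]_(i < n) val (tnth x i)) ->
  totally_associative f.
Proof.
move=> val_f x i j; apply: val_inj.
suff flat k : val (nested f x k) =
    \big[op/idx]_(0 <= l < n + n.-1) val (x l) by rewrite !flat.
rewrite -(big_nested op (fun l => val (x l)) k) val_f.
apply: eq_bigr => l _; rewrite tnth_mktuple; do 2!case: ifP => // _.
by rewrite val_f; apply: eq_bigr => h _; rewrite tnth_mktuple.
Qed.

Lemma val_big_permutation_invariant (R : Type) (idx : R)
    (op : Monoid.com_law idx) (P : pred R) (A : subType P) (n : nat)
    (f : nary_op n A) :
  (forall x, val (f x) = \big[op/idx]_(i < n) val (tnth x i)) ->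
  permutation_invariant f.
Proof.
move=> val_f s x; apply: val_inj; rewrite !val_f.
rewrite [RHS](reindex_inj (@perm_inj _ s)).
by apply: eq_bigr => i _; rewrite tnth_mktuple.
Qed.

Lemma big_replace (R : Type) (idx : R) (op : Monoid.com_law idx) (A : Type)
    (v : A -> R) (n : nat) (t : n.-tuple A) (i : 'I_n) (y : A) :
  \big[op/idx]_(k < n) v (tnth (replace t i y) k) =
  op (v y) (\big[op/idx]_(k < n | k != i) v (tnth t k)).
Proof.
rewrite (bigD1 i) //= tnth_mktuple eqxx; congr (op _ _).
by apply: eq_bigr => k /negPf ki; rewrite tnth_mktuple ki.
Qed.

Lemma val_sum_prod_distributive (R : comPzRingType) (P : pred R)
    (A : subType P) (m n : nat) (nu : nary_op m A) (mu : nary_op n A) :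
  (forall x, val (nu x) = \sum_(i < m) val (tnth x i)) ->
  (forall x, val (mu x) = \prod_(i < n) val (tnth x i)) ->
  distributive_on_every_place nu mu.
Proof.
move=> val_nu val_mu i t y; apply: val_inj.
rewrite val_mu big_replace /= !val_nu mulr_suml.
by apply: eq_bigr => k _; rewrite tnth_mktuple val_mu big_replace.
Qed.

(** The solution is c minus the m - 1 other entries; these sum to m a - a
    modulo b, that is to 0, so the difference stays in the class. *)
Lemma residue_class_sum_solvable (a b : int) (m : nat)
    (nu : nary_op m (residue_class a b)) :
  (b %| m%:Z * a - a)%Z ->
  (forall x, val (nu x) = \sum_(i < m) val (tnth x i)) ->
  solvable_on_any_place nu.
Proof.
move=> ma_a val_nu i t c.
pose s := \sum_(k < m | k != i) val (tnth t k).
have cs : val c - s \in residue_class a b.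
  rewrite mem_residue_class.
  have sa : (b %| s - \sum_(k < m | k != i) a)%Z.
    by apply: sum_congr => k _; apply: dvdz_residue.
  have Ea : \sum_(k < m | k != i) a = m%:Z * a - a.
    have : \sum_(k < m) a = m%:Z * a.
      by rewrite sumr_const card_ord -mulr_natl natz.
    by move=> <-; rewrite [in RHS](bigD1 i) //= [a + _]addrC addrK.
  rewrite Ea in sa; have := rpredB (dvdz_residue c) (rpredD sa ma_a).
  by rewrite subrK [val c - a - s]addrAC.
exists (exist _ (val c - s) cs); apply: val_inj.
by rewrite val_nu big_replace /= -/s subrK.
Qed.

Lemma ratio_int (b x : int) :
  b != 0 -> (b %| x)%Z -> x%:Q / b%:Q \is a Num.int.
Proof. by move=> b0 /dvdzP[k ->]; rewrite intrM mulfK ?intr_eq0. Qed.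

Theorem theorem6p8 (a b : int) (hb : 1 <= b) (ha0 : 0 <= a) (hab : a <= b - 1)
  (m n : nat) (hmn : minimal_arities a b m n) :
  (exists (nu : nary_op m (residue_class a b))
          (mu : nary_op n (residue_class a b)),
     [/\ forall x : m.-tuple (residue_class a b),
           val (nu x) = \sum_(i < m) val (tnth x i),
         forall x : n.-tuple (residue_class a b),
           val (mu x) = \prod_(i < n) val (tnth x i)
       & polyadic_ring nu mu]) /\
  ((m%:Q - 1) * (a%:Q / b%:Q) \is a Num.int) /\
  ((a%:Q ^+ n - a%:Q) / b%:Q \is a Num.int).
Proof.
case: hmn => _ _ [/eqP ma_a /eqP an_a] _; rewrite !eqz_mod_dvd in ma_a an_a.
have b0 : b != 0 by rewrite gt_eqF // (lt_le_trans ltr01 hb).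
split; last split; last first.
- by rewrite -rmorphXn -intrB; apply: ratio_int.
- rewrite mulrA mulrBl mul1r -intrM -intrB; exact: ratio_int.
pose nu : nary_op m (residue_class a b) := fun x =>
  exist _ (\sum_i val (tnth x i))
    (residue_class_sum ma_a (fun i => dvdz_residue (tnth x i))).
pose mu : nary_op n (residue_class a b) := fun x =>
  exist _ (\prod_i val (tnth x i))
    (residue_class_prod an_a (fun i => dvdz_residue (tnth x i))).
have val_nu x : val (nu x) = \sum_(i < m) val (tnth x i) by [].
have val_mu x : val (mu x) = \prod_(i < n) val (tnth x i) by [].
exists nu, mu; split=> //; split.
- exact: val_sum_prod_distributive val_nu val_mu.
- exact: val_big_associative val_mu.
split.
- exact: val_big_associative val_nu.
- exact: val_big_permutation_invariant val_nu.
- exact: residue_class_sum_solvable ma_a val_nu.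
Qed.
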